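(* Let $G$ be a Cayley graph of a group $\Gamma$ and let $H$ be an infinite subgroup of $\Gamma$. For each $p\in[0,1]$ there exists $k_p\in\{0,1,\infty\}$ such that the number of $H$-infinite clusters in $G_p$ is equal to $k_p$ almost surely.
   Context: Cayley graphs are taken with respect to finite generating sets (so they are connected and locally finite, with vertex set $\Gamma$). $G_p$ denotes Bernoulli bond percolation on $G$: each edge is independently retained (open) with probability $p$ and deleted otherwise; connected components of $G_p$ are called clusters. For a set $A$ of vertices, a cluster $K$ is called $A$-infinite if $|K\cap A|=\infty$. *)

(* Defs.v *)
From HB Require Import structures.
From Stdlib Require Export Relation_Operators.
From mathcomp Require Export all_boot all_order all_algebra finmap.
From mathcomp Require Export all_classical all_reals all_analysis.

Set Implicit Arguments.
Unset Strict Implicit.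
Unset Printing Implicit Defensive.
Import Order.TTheory GRing.Theory Num.Theory.

Local Open Scope classical_set_scope.

Definition generates (Gamma : groupType) (S : seq Gamma) : Prop :=
  forall K : {pred Gamma}, group_closed K -> {subset S <= K} ->
  forall g : Gamma, g \in K.

(* Edges are unordered pairs [set g; g * s], so each geometric edge occurs only
   once, even if both s and s^-1 belong to S; the condition s != 1 excludes
   loops. *)
Definition cayley_edges (Gamma : groupType) (S : seq Gamma) :
    set (set Gamma) :=
  [set e | exists g s : Gamma,
     [/\ s \in S, s != 1%g & e = [set g; (g * s)%g]]].

Definition mutually_independent (d : measure_display) (Omega : measurableType d)
    (R : realType) (P : probability Omega R) (I : choiceType) (D : set I)
    (A : I -> set Omega) : Prop :=
  forall J : {fset I}, [set` J] `<=` D ->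
    P (\bigcap_(i in [set` J]) A i) = (\prod_(i <- J) P (A i))%E.

(* W w is the set of open edges, for a graph with edge set E. *)
Definition bernoulli_percolation (d : measure_display)
    (Omega : measurableType d) (R : realType) (P : probability Omega R)
    (V : choiceType) (E : set (set V)) (p : R) (W : Omega -> set (set V)) :
    Prop :=
  [/\ forall w, W w `<=` E,
      forall e, E e -> measurable [set w | W w e],
      forall e, E e -> P [set w | W w e] = p%:E
    & mutually_independent P E (fun e => [set w | W w e])].

Definition cluster_of (V : Type) (O : set (set V)) (x : V) : set V :=
  [set y | clos_refl_trans V (fun u v => O [set u; v]) x y].

Definition clusters (V : Type) (O : set (set V)) : set (set V) :=
  range (cluster_of O).

Definition infinite_clusters (V : Type) (A : set V) (O : set (set V)) :
    set (set V) :=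
  [set K | clusters O K /\ infinite_set (K `&` A)].

(* Main.v *)
From HB Require Import structures.
From Stdlib Require Import Operators_Properties.
Require Import Defs.
From mathcomp Require Import ring lra.

Set Implicit Arguments.
Unset Strict Implicit.
Unset Printing Implicit Defensive.
Import Order.TTheory GRing.Theory Num.Theory.
Local Open Scope classical_set_scope.
Local Open Scope ring_scope.

(** The subgroup H acts on the Cayley graph by left translations. These
preserve both the law of the percolation and the number of H-infinite
clusters, because h K `&` H = h (K `&` H) for h in H. As H is infinite, every
finite set of edges can be moved off any other one, so the action is mixing
and every H-invariant event has probability 0 or 1 (invariant_zero_one).
This applies to the events that there are at least n H-infinite clusters
(at_least_zero_one), so their number is almost surely constant.

A finite constant n >= 2 is impossible for p > 0. Opening a given finite set of
edges cannot give a null event positive probability (null_insert), so almost surely the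
number of H-infinite clusters remains n after any finite path of edges has been
opened. But opening a path between two distinct H-infinite clusters merges
them, and every H-infinite cluster of the enlarged configuration contains one
of the original configuration, as only finitely many edges were added; n
clusters after the merger thus require n + 1 before it
(many_clusters_merge). For p = 0 all clusters are single vertices.

The constant has to be the same for all probability spaces that carry such a
percolation. So everything is proved for the law of the open set, a probability
measure on the space of all sets of edges, with the sigma-algebra generated by
the events that finitely many given edges are open. These events are stable
under intersection, so their probabilities p ^ n determine the law
(config_measure_unique), which gives its translation invariance and the
insertion identity as well. *)

(** * The law of Bernoulli percolation *)

Definition all_open (X : choiceType) (J : {fset X}) : set (set X) :=
  [set O | [set` J] `<=` O].

Definition cylinders (X : choiceType) (E : set X) : set (set (set X)) :=
  [set all_open J | J in [set J : {fset X} | [set` J] `<=` E]].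

(** Configurations range over all sets of X, not just subsets of E: only the
edges in E are observed by the sigma-algebra. Events that depend on a
configuration O are therefore phrased in terms of O `&` E below. *)
Definition config (X : choiceType) (E : set X) :=
  g_sigma_algebraType (cylinders E).

Definition image_law d d' (T : measurableType d) (T' : measurableType d')
    (R : realType) (P : probability T R) (f : T -> T')
    (mf : measurable_fun setT f) : probability T' R :=
  distribution P (mfun_Sub (mem_set mf)).

Section bernoulli_law.
Context (X : choiceType) (E : set X) (R : realType).
Implicit Types (J F : {fset X}) (O : set X) (B : set (config E)).

Lemma all_open0 : all_open (fset0 : {fset X}) = setT.
Proof. by apply/seteqP; split=> // O _ x /=; rewrite in_fset0. Qed.

Lemma all_openI J F : all_open J `&` all_open F = all_open (J `|` F)%fset.
Proof.
apply/seteqP; split=> O /=.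
  by move=> [JO FO] x /=; rewrite inE => /orP[/JO|/FO].
by move=> JFO; split=> x xJ; apply: JFO => /=; rewrite inE xJ ?orbT.
Qed.

Lemma cylinders_setI_closed : setI_closed (cylinders E).
Proof.
move=> _ _ [J JE <-] [F FE <-]; rewrite all_openI; exists (J `|` F)%fset => //.
by move=> x /=; rewrite inE => /orP[/JE|/FE].
Qed.

Lemma measurable_all_open J :
  [set` J] `<=` E -> measurable (all_open J : set (config E)).
Proof. by move=> JE; apply: sub_gen_smallest; exists J. Qed.

Lemma measurable_open_edge (e : X) :
  E e -> measurable ([set O | O e] : set (config E)).
Proof.
move=> Ee; have -> : [set O | O e] = all_open [fset e]%fset.
  apply/seteqP; split=> O /=; first by move=> Oe x /=; rewrite inE => /eqP->.
  by apply; rewrite /= inE.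
by apply: measurable_all_open => x /=; rewrite inE => /eqP->.
Qed.

Lemma measurable_to_config d (T : measurableType d) (f : T -> config E) :
  (forall J, [set` J] `<=` E -> measurable (f @^-1` all_open J)) ->
  measurable_fun setT f.
Proof.
move=> mf; apply: (@measurability _ _ T (config E) setT f (cylinders E)) => //.
move=> _ [_ [J JE <-] <-].
by rewrite setTI; exact: mf.
Qed.

Lemma measurable_preimage_config d (T : measurableType d) (f : T -> config E) B :
  measurable_fun setT f -> measurable B -> measurable (f @^-1` B).
Proof. by move=> mf mB; rewrite -[X in measurable X]setTI; exact: mf. Qed.

Lemma config_measure_unique (m1 m2 : {measure set (config E) -> \bar R}) :
  (m1 setT < +oo)%E ->
  (forall J, [set` J] `<=` E -> m1 (all_open J) = m2 (all_open J)) ->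
  forall B, measurable B -> m1 B = m2 B.
Proof.
move=> m1fin m12 B mB.
apply: (@measure_unique _ R (config E) (cylinders E) (fun=> setT)) => //.
- exact: cylinders_setI_closed.
- by move=> _; rewrite -all_open0; exists fset0 => // x /=; rewrite in_fset0.
- by apply/seteqP; split=> // x _; exists 0%N.
- by move=> _ [J JE <-]; exact: m12.
Qed.

Definition bernoulli_law (p : R) (mu : probability (config E) R) :=
  forall J, [set` J] `<=` E -> mu (all_open J) = (p ^+ #|` J|)%:E.

Section fixed_law.
Variables (p : R) (mu : probability (config E) R).
Hypothesis lawmu : bernoulli_law p mu.

Let pr B : R := fine (mu B).

Let prE B : measurable B -> mu B = (pr B)%:E.
Proof. by move=> mB; rewrite fineK// fin_num_measure. Qed.

Let pr_ge0 B : 0 <= pr B.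
Proof. by rewrite fine_ge0. Qed.

Let prT : pr setT = 1.
Proof. by rewrite /pr probability_setT. Qed.

Let le_pr A B : measurable A -> measurable B -> A `<=` B -> pr A <= pr B.
Proof. by move=> mA mB AB; rewrite -lee_fin -!prE// le_measure ?inE. Qed.

Let prD A B : measurable A -> measurable B -> B `<=` A ->
  pr (A `\` B) = pr A - pr B.
Proof.
move=> mA mB BA; apply/EFin_inj; rewrite EFinB -!prE//; last exact: measurableD.
rewrite measureD//; last by rewrite -ge0_fin_numE// fin_num_measure.
by rewrite setIidr.
Qed.

Let prU A B : measurable A -> measurable B -> A `&` B = set0 ->
  pr (A `|` B) = pr A + pr B.
Proof.
move=> mA mB AB; apply/EFin_inj; rewrite EFinD -!prE//; last exact: measurableU.
by rewrite measureU.
Qed.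

Definition relabel (phi : X -> X) (O : config E) : config E := phi @^-1` O.

Section relabel.
Variables (phi : X -> X) (phi_inj : injective phi).
Hypothesis phiE : forall e, E e -> E (phi e).

Lemma preimage_relabel J :
  relabel phi @^-1` all_open J = all_open (phi @` J)%fset.
Proof.
apply/seteqP; split=> O /=.
  by move=> JO x /= /imfsetP[e /= eJ ->]; exact: JO.
by move=> JO e /= eJ; apply: JO => /=; rewrite in_imfset.
Qed.

Lemma sub_relabel J : [set` J] `<=` E -> [set` (phi @` J)%fset] `<=` E.
Proof. by move=> JE x /= /imfsetP[e /= eJ ->]; exact/phiE/JE. Qed.

Lemma measurable_relabel : measurable_fun setT (relabel phi).
Proof.
apply: measurable_to_config => J JE; rewrite preimage_relabel.
by apply: measurable_all_open; apply: sub_relabel.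
Qed.

(** Relabelling permutes the generating cylinders without changing the number
of edges that they prescribe. *)
Lemma bernoulli_law_relabel B : measurable B -> mu (relabel phi @^-1` B) = mu B.
Proof.
move=> mB; rewrite -[LHS]/(image_law mu measurable_relabel B).
apply: config_measure_unique => //.
  by rewrite (le_lt_trans (probability_le1 _ _)) ?ltry.
move=> J JE; rewrite /image_law/= /distribution/= /pushforward/=.
rewrite preimage_relabel !lawmu ?card_imfset//; exact: sub_relabel.
Qed.

End relabel.

Section insertion.
Variable F : {fset X}.
Hypothesis FE : [set` F] `<=` E.

Definition insert_edges (O : config E) : config E := O `|` [set` F].

Lemma preimage_insert_edges J :
  insert_edges @^-1` all_open J = all_open (J `\` F)%fset.
Proof.
apply/seteqP; split=> O /= JO e /=; rewrite ?inE.
  by move=> /andP[/negP eF /JO[]].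
move=> eJ; have [eF|eF] := boolP (e \in F); [by right|left].
by apply: JO => /=; rewrite inE eF.
Qed.

Lemma sub_fsetD J : [set` J] `<=` E -> [set` (J `\` F)%fset] `<=` E.
Proof. by move=> JE e /=; rewrite inE => /andP[_ /JE]. Qed.

Lemma measurable_insert_edges : measurable_fun setT insert_edges.
Proof.
apply: measurable_to_config => J JE; rewrite preimage_insert_edges.
by apply: measurable_all_open; apply: sub_fsetD.
Qed.

(** Given that the edges in F are open, the other ones are still independent
with parameter p: both sides are measures in B, and on a cylinder they are
powers of p with the same exponent #|J `|` F| = #|F| + #|J `\` F|. *)
Lemma bernoulli_law_insert B : 0 <= p -> measurable B ->
  mu (B `&` all_open F) = ((p ^+ #|` F|)%:E * mu (insert_edges @^-1` B))%E.
Proof.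
move=> p0 mB; have pF0 : 0 <= p ^+ #|` F| by rewrite exprn_ge0.
pose m1 := mrestr mu (measurable_all_open FE).
pose m2 := mscale (NngNum pF0) (image_law mu measurable_insert_edges).
apply: (config_measure_unique (m1 := m1) (m2 := m2)) => //.
  by rewrite /m1 /= /mrestr setTI lawmu// ltry.
move=> J JE; rewrite /m1 /m2 /= /mrestr /mscale /= /image_law/=.
rewrite /distribution/= /pushforward/= preimage_insert_edges all_openI.
rewrite !lawmu; [|exact: sub_fsetD|by move=> e /=; rewrite inE => /orP[/JE|/FE]].
rewrite -EFinM -exprD; congr (_ ^+ _)%:E.
by rewrite -[LHS](cardfsID F) fsetIC fsetKUC fsetDUl fsetDv fsetU0.
Qed.

End insertion.

(** Insertion tolerance: opening finitely many edges by hand cannot make a null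
event happen with positive probability. *)
Lemma null_insert (F : {fset X}) B : 0 < p -> [set` F] `<=` E ->
  measurable B -> mu B = 0%E -> mu (insert_edges F @^-1` B) = 0%E.
Proof.
move=> p0 FE mB B0.
have mBF : measurable (insert_edges F @^-1` B : set (config E)).
  by apply: measurable_preimage_config => //; exact: measurable_insert_edges.
have : mu (B `&` all_open F) = 0%E.
  apply: (@subset_measure0 _ _ _ mu _ B) => //.
  apply: measurableI => //; exact: measurable_all_open.
rewrite bernoulli_law_insert ?(ltW p0)// => /eqP; rewrite mule_eq0.
by rewrite eqe expf_eq0 (gt_eqF p0) andbF => /eqP.
Qed.

(** The maps phi h, with h in the infinite set H, stand for an action on the
edges. No group structure is involved in the zero-one law: injectivity makes
the maps preserve the law, and phi_displaces lets them move finite sets of edges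
off each other. *)
Section zero_one.
Variables (K : choiceType) (H : set K) (phi : K -> X -> X).
Hypothesis infH : infinite_set H.
Hypothesis phi_inj : forall h, injective (phi h).
Hypothesis phiE : forall h e, E e -> E (phi h e).
Hypothesis phi_displaces : forall e e', E e -> E e' ->
  finite_set (H `&` [set h | phi h e = e']).

Lemma finite_overlap J F : [set` J] `<=` E -> [set` F] `<=` E ->
  finite_set (H `&` [set h | ~~ [disjoint (phi h @` J)%fset & F]%fset]).
Proof.
move=> JE FE.
apply: (@sub_finite_set _ _ (\bigcup_(e in [set` J]) \bigcup_(e' in [set` F])
    (H `&` [set h | phi h e = e']))).
  move=> h [Hh /= /fset0Pn[x]]; rewrite inE => /andP[/imfsetP[e /= eJ ->] eF].
  by exists e => //; exists (phi h e).
apply: bigcup_finite => // e /JE Ee; apply: bigcup_finite => // e' /FE Ee'.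
exact: phi_displaces.
Qed.

Section mixing.
Variable J : {fset X}.
Hypothesis JE : [set` J] `<=` E.

Let moved h B : set (config E) := relabel (phi h) @^-1` B `&` all_open J.

Let mmoved h B : measurable B -> measurable (moved h B).
Proof.
move=> mB; apply: measurableI; last exact: measurable_all_open.
apply: measurable_preimage_config => //; apply: measurable_relabel.
exact: phiE.
Qed.

Let defect h B : R :=
  `|pr (moved h B) - p ^+ #|` J| * pr B|.

(** Convergence of defect h B to 0 along the cofinite filter of H, written with
finite exceptional sets: the event B moved far away becomes independent of
all_open J. *)
Definition mixes_with B := forall eps : R, 0 < eps ->
  finite_set (H `&` [set h | eps <= defect h B]).

(** For all but finitely many h the moved edges are disjoint from J, and then
independence is exact. *)
Lemma mixes_with_all_open F : [set` F] `<=` E -> mixes_with (all_open F).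
Proof.
move=> FE eps eps0; apply: sub_finite_set (finite_overlap FE JE) => h [Hh] /=.
move=> le_eps; split=> //; apply/negP => dis; move: le_eps; apply/negP.
rewrite -ltNge /defect /moved /pr preimage_relabel all_openI !lawmu//; last first.
  move=> e /=; rewrite inE => /orP[|/JE//]; move: e; apply: sub_relabel FE.
  exact: phiE.
rewrite /= -exprD; suff -> : #|` (phi h @` F `|` J)%fset| = (#|` J| + #|` F|)%N.
  by rewrite subrr normr0.
have cphi : #|` (phi h @` F)%fset| = #|` F| by rewrite card_imfset.
rewrite addnC -cphi -cardfsUI.
by move: dis => /eqP ->; rewrite cardfs0 addn0.
Qed.

Lemma mixes_withC B : measurable B -> mixes_with B -> mixes_with (~` B).
Proof.
move=> mB mixB eps /mixB; apply: sub_finite_set => h [Hh] /= le_eps.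
split=> //; apply: le_trans le_eps _; rewrite le_eqVlt; apply/orP; left.
apply/eqP; rewrite /defect.
have -> : moved h (~` B) = all_open J `\` moved h B.
  by rewrite /moved setDIr setDv setU0 preimage_setC setDE setIC.
have mJ := measurable_all_open JE.
rewrite prD; [|exact: mJ|exact: mmoved|exact: subIsetr].
rewrite -setTD prD// prT {1}/pr lawmu//= -normrN; congr `|_|; ring.
Qed.

Lemma mixes_withU A B : measurable A -> measurable B -> A `&` B = set0 ->
  mixes_with A -> mixes_with B -> mixes_with (A `|` B).
Proof.
move=> mA mB AB mixA mixB eps eps0; have eps2 : 0 < eps / 2 by rewrite divr_gt0.
apply: (@sub_finite_set _ _ ((H `&` [set h | eps / 2 <= defect h A]) `|`
                             (H `&` [set h | eps / 2 <= defect h B]))); last first.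
  by rewrite finite_setU; split; [exact: mixA|exact: mixB].
move=> h [Hh] /= le_eps.
suff : defect h (A `|` B) <= defect h A + defect h B.
  move=> le_sum; have [?|ltA] := leP (eps / 2) (defect h A); first by left.
  by right; split=> //=; lra.
rewrite /defect (_ : moved h (A `|` B) = moved h A `|` moved h B); last first.
  by rewrite /moved preimage_setU setIUl.
rewrite !prU//; [|exact: mmoved|exact: mmoved|]; last first.
  by rewrite /moved setIACA -preimage_setI AB preimage_set0 set0I.
apply: le_trans (ler_normD _ _); rewrite le_eqVlt; apply/orP; left; apply/eqP.
by congr `|_|; ring.
Qed.

(** The defects of the partial unions are close to those of the full union,
uniformly in h, since relabelling preserves the law. *)
Lemma mixes_with_bigcup (F : (set (config E))^nat) :
  (forall n, measurable (F n)) -> trivIset setT F ->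
  (forall n, mixes_with (F n)) -> mixes_with (\bigcup_k F k).
Proof.
move=> mF tF mixF eps eps0.
pose G n : set (config E) := \big[setU/set0]_(i < n) F i.
have mG n : measurable (G n) by apply: bigsetU_measurable.
have mU : measurable (\bigcup_k F k) by apply: bigcupT_measurable.
have mixG n : mixes_with (G n).
  elim: n => [|n IHn]; rewrite /G.
    rewrite big_ord0 -setCT -all_open0; apply: mixes_withC.
      by rewrite all_open0.
    by apply: mixes_with_all_open => x /=; rewrite in_fset0.
  rewrite big_ord_recr; apply: mixes_withU => //; rewrite -/(G n); first exact: mG.
  apply/seteqP; split=> // O []; rewrite /G -bigcup_mkord => -[i /= lt_in FiO] FnO.
  by have := tF i n I I; move: lt_in => /[swap] -> //; [rewrite ltnn|exists O].
have GU n : G n `<=` \bigcup_k F k.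
  by rewrite /G -bigcup_mkord; apply: bigcup_subset.
(* The factor 4 leaves eps / 2 for the defect of G n: the two error terms below
   are at most eps / 4 each. *)
have [n Gn] : exists n, pr (\bigcup_k F k) - pr (G n) < eps / 4.
  have : mu \o (fun n => G n.+1) @ \oo --> mu (\bigcup_k F k).
    rewrite -bigcup_bigsetU_bigcup; apply: nondecreasing_cvg_mu => //.
      exact: bigcupT_measurable.
    by move=> m n mn; apply/subsetPset; apply: subset_bigsetU.
  rewrite prE// => /fine_cvg /cvgrPdist_lt /(_ (eps / 4)) [|n _ /(_ n (leqnn n))].
    by rewrite divr_gt0.
  by move=> /= /(le_lt_trans (ler_norm _)) ltn; exists n.+1.
apply: sub_finite_set (mixG n (eps / 2) _); last by rewrite divr_gt0.
move=> h [Hh] /= le_eps; split=> //=.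
have subm : moved h (G n) `<=` moved h (\bigcup_k F k).
  by apply: setSI; apply: preimage_subset; exact: GU.
have le_moved : pr (moved h (\bigcup_k F k)) - pr (moved h (G n)) <=
    pr (\bigcup_k F k) - pr (G n).
  rewrite -!prD//; [|exact: mmoved|exact: mmoved].
  rewrite -[leRHS](_ : pr (relabel (phi h) @^-1` (\bigcup_k F k `\` G n)) = _).
    apply: le_pr; first by apply: measurableD; exact: mmoved.
      apply: measurable_preimage_config; last exact: measurableD.
      by apply: measurable_relabel; exact: phiE.
    by move=> O [[UO JO] notG]; split=> // GO; exact: notG.
  by rewrite /pr bernoulli_law_relabel//; [exact: phiE|exact: measurableD].
have ge_moved : pr (moved h (G n)) <= pr (moved h (\bigcup_k F k)).
  by apply: le_pr => //; exact: mmoved.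
have ge_G : pr (G n) <= pr (\bigcup_k F k) by apply: le_pr.
have q1 : p ^+ #|` J| <= 1.
  by rewrite -lee_fin -lawmu// probability_le1//; exact: measurable_all_open.
have q0 : 0 <= p ^+ #|` J| by rewrite -lee_fin -lawmu.
move: le_eps; rewrite /defect.
set u := pr (moved h (\bigcup_k F k)) in le_moved ge_moved *.
set v := pr (moved h (G n)) in le_moved ge_moved *.
set x := pr (\bigcup_k F k) in Gn le_moved ge_G *.
set y := pr (G n) in Gn le_moved ge_G *.
set q := p ^+ #|` J| in q0 q1 *.
move=> le_eps.
have : `|u - q * x| <= `|v - q * y| + `|u - v| + `|q * (x - y)|.
  rewrite (_ : u - q * x = (v - q * y) + (u - v) - q * (x - y)); last by ring.
  by rewrite (le_trans (ler_normB _ _))// lerD2r ler_normD.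
rewrite (ger0_norm (_ : 0 <= u - v)) ?subr_ge0//.
rewrite (ger0_norm (_ : 0 <= q * (x - y))) ?mulr_ge0 ?subr_ge0//.
have : q * (x - y) <= x - y by rewrite ler_piMl ?subr_ge0.
move: le_eps Gn le_moved; lra.
Qed.

(** The cylinders are stable under intersection and the class of mixing events
is a Dynkin system. *)
Lemma mixes_with_measurable B : measurable B -> mixes_with B.
Proof.
apply: (@dynkin_induction _ (config E) (cylinders E)) => //.
- exact: cylinders_setI_closed.
- rewrite -all_open0; apply: mixes_with_all_open => x /=; by rewrite in_fset0.
- by move=> _ [F FE <-]; exact: mixes_with_all_open.
- exact: mixes_withC.
- exact: mixes_with_bigcup.
Qed.

(** For an invariant event the defect does not depend on h, so mixing forces it
to vanish. *)
Lemma invariant_indep_all_open B : measurable B ->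
  (forall h, H h -> relabel (phi h) @^-1` B = B) ->
  mu (B `&` all_open J) = ((p ^+ #|` J|)%:E * mu B)%E.
Proof.
move=> mB invB; have mBJ : measurable (B `&` all_open J).
  by apply: measurableI => //; exact: measurable_all_open.
rewrite !prE// -EFinM; congr _%:E; apply/eqP; rewrite -subr_eq0; apply/negPn/negP.
rewrite -normr_gt0 => /(mixes_with_measurable mB) finH; apply: infH.
apply: sub_finite_set finH => h Hh; split=> //=.
by rewrite /defect /moved invB.
Qed.

End mixing.

(** An invariant event B is independent of every cylinder, hence of every
event, hence of itself, so that its probability equals its own square. *)
Lemma invariant_zero_one B : measurable B ->
  (forall h, H h -> relabel (phi h) @^-1` B = B) -> mu B = 0%E \/ mu B = 1%E.
Proof.
move=> mB invB.
pose m1 := mrestr mu mB.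
pose m2 := mscale (NngNum (pr_ge0 B)) mu.
have m12 : m1 B = m2 B.
  apply: config_measure_unique => //.
    by rewrite /m1 /= /mrestr setTI prE// ltry.
  move=> J JE; rewrite /m1 /m2 /= /mrestr /mscale /= setIC.
  by rewrite invariant_indep_all_open// lawmu// prE// -!EFinM mulrC.
move: m12; rewrite /m1 /m2 /= /mrestr /mscale /= setIid prE// -EFinM => -[].
rewrite /= => prB; have /eqP : pr B * (pr B - 1) = 0 by rewrite mulrBr mulr1 -prB subrr.
by rewrite mulf_eq0 subr_eq0 => /orP[] /eqP ->; [left|right].
Qed.

End zero_one.
End fixed_law.
End bernoulli_law.

(** The product rule over finite sets of edges gives the cylinders the
probabilities p ^ n that define the law. *)
Lemma bernoulli_percolation_law (V : choiceType) (E : set (set V))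
    (R : realType) (p : R) d (Omega : measurableType d) (P : probability Omega R)
    (W : Omega -> set (set V)) :
  bernoulli_percolation P E p W ->
  exists mW : measurable_fun setT (W : Omega -> config E),
    bernoulli_law p (image_law P mW).
Proof.
move=> [WE mW PW indW].
have preW (J : {fset set V}) :
    W @^-1` all_open J = \bigcap_(e in [set` J]) [set w | W w e].
  by apply/seteqP; split=> w /= JW e eJ; exact: JW.
have mfW : measurable_fun setT (W : Omega -> config E).
  apply: measurable_to_config => J JE; rewrite preW.
  by apply: fin_bigcap_measurable => // e /JE; exact: mW.
exists mfW => J JE; rewrite /image_law/= /distribution/= /pushforward/= preW.
rewrite indW// (eq_big_seq (fun=> p%:E)) => [|e /JE Ee]; last by rewrite PW.
by rewrite prodEFin big_const_seq count_predT -Monoid.iteropE.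
Qed.

(** * Combinatorics of infinite clusters *)

Section clusters.
Variable V : choiceType.
Implicit Types (O : set (set V)) (x y z : V) (A Z : set V) (s : seq V).

Lemma cluster_refl O x : cluster_of O x x.
Proof. exact: rt_refl. Qed.

Lemma cluster_trans O x y z :
  cluster_of O x y -> cluster_of O y z -> cluster_of O x z.
Proof. exact: rt_trans. Qed.

Lemma cluster_sym O x y : cluster_of O x y -> cluster_of O y x.
Proof.
elim=> [u v Ouv|u|u v w _ vu _ wv]; [|exact: rt_refl|exact: rt_trans wv vu].
by apply: rt_step; rewrite setUC.
Qed.

Lemma cluster_eqP O x y : cluster_of O x = cluster_of O y <-> cluster_of O x y.
Proof.
split=> [->|xy]; first exact: cluster_refl.
apply/seteqP; split=> z; last exact: cluster_trans.
exact/cluster_trans/cluster_sym.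
Qed.

Lemma sub_cluster O O' : O `<=` O' ->
  forall x, cluster_of O x `<=` cluster_of O' x.
Proof.
move=> OO' x y; elim=> [u v Ouv|u|u v w _ uv _ vw].
- by apply: rt_step; exact: OO'.
- exact: rt_refl.
- exact: rt_trans uv vw.
Qed.

Lemma cluster_finite_path O x y : cluster_of O x y ->
  exists2 J : {fset set V}, [set` J] `<=` O & cluster_of [set` J] x y.
Proof.
elim=> [u v Ouv|u|u v w _ [J JO uv] _ [F FO vw]].
- exists [fset [set u; v]]%fset; first by move=> e /=; rewrite inE => /eqP ->.
  by apply: rt_step; rewrite /= inE.
- by exists fset0 => [e /=|]; [rewrite in_fset0|exact: rt_refl].
- exists (J `|` F)%fset; first by move=> e /=; rewrite inE => /orP[/JO|/FO].
  apply: (@rt_trans _ _ _ v).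
    by apply: sub_cluster uv => e /= eJ; rewrite inE eJ.
  by apply: sub_cluster vw => e /= eF; rewrite inE eF orbT.
Qed.

(** Clusters are counted through representatives, which makes these events
countable combinations of connection events. *)
Definition many_clusters A (n : nat) O := exists s,
  [/\ size s = n, uniq s,
      forall x, x \in s -> infinite_set (cluster_of O x `&` A)
    & forall x y, x \in s -> y \in s -> cluster_of O x y -> x = y].

Lemma many_clusters0 A O : many_clusters A 0 O.
Proof. by exists [::]. Qed.

(** Going back from O `|` F to O, where the ends of F lie in the finite set Z,
cuts the cluster of x into pieces, each of which contains x or a point of Z: a
walk from x is cut at its last step outside O. One of these finitely many pieces is
A-infinite. *)
Lemma infinite_cluster_remove A O F Z x : finite_set Z ->
  (forall u v, F [set u; v] -> Z u) ->
  infinite_set (cluster_of (O `|` F) x `&` A) ->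
  exists2 a, cluster_of (O `|` F) x a & infinite_set (cluster_of O a `&` A).
Proof.
move=> finZ FZ infx; apply: contrapT => noa; apply: infx.
pose D := cluster_of (O `|` F) x `&` (x |` Z).
apply: (@sub_finite_set _ _ (\bigcup_(a in D) (cluster_of O a `&` A))).
  move=> y [xy Ay]; suff [a Da ay] : exists2 a, D a & cluster_of O a y.
    by exists a.
  elim: (clos_rt_rtn1 _ _ _ _ xy) => [|u v uv xu [a Da au]].
    by exists x; [split; [exact: cluster_refl|left]|exact: cluster_refl].
  case: (uv) => [Ouv|Fuv].
    by exists a => //; apply: cluster_trans au _; exact: rt_step.
  exists v; last exact: cluster_refl.
  split; last by right; apply: (FZ v u); rewrite setUC.
  by apply: cluster_trans (clos_rtn1_rt _ _ _ _ xu) _; exact: rt_step.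
apply: bigcup_finite => [|a [xa _]].
  by apply: finite_setIr; rewrite finite_setU.
by apply: contrapT => infa; apply: noa; exists a.
Qed.

(** Each of the n A-infinite clusters of O `|` F contains an A-infinite cluster
of O. At most one of the n is the cluster that contains both x and y, and this
one contains two A-infinite clusters of O; if there is none, then x simply
provides one more cluster. *)
Lemma many_clusters_merge A n O F Z x y : finite_set Z ->
  (forall u v, F [set u; v] -> Z u) ->
  infinite_set (cluster_of O x `&` A) -> infinite_set (cluster_of O y `&` A) ->
  ~ cluster_of O x y -> cluster_of (O `|` F) x y ->
  many_clusters A n (O `|` F) -> many_clusters A n.+1 O.
Proof.
move=> finZ FZ infx infy nxy xy [s [sz_s uniq_s inf_s apart_s]].
have /choice[a aP] u : exists v, u \in s ->
    cluster_of (O `|` F) u v /\ infinite_set (cluster_of O v `&` A).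
  have [us|us] := boolP (u \in s); last by exists u.
  by have [v uv infv] := infinite_cluster_remove finZ FZ (inf_s _ us); exists v.
have up u v : cluster_of O u v -> cluster_of (O `|` F) u v.
  by apply: sub_cluster; exact: subsetUl.
have apart u v : u \in s -> v \in s -> cluster_of (O `|` F) (a u) (a v) -> u = v.
  move=> us vs auv; apply: apart_s => //.
  have [uau _] := aP _ us; have [vav _] := aP _ vs.
  exact: cluster_trans uau (cluster_trans auv (cluster_sym vav)).
pose t := map a s.
have uniq_t : uniq t.
  by rewrite map_inj_in_uniq// => u v us vs auv; apply: apart => //; rewrite auv;
    exact: cluster_refl.
have inf_t w : w \in t -> infinite_set (cluster_of O w `&` A).
  by move=> /mapP[u us ->]; have [] := aP _ us.
have apart_t v w : v \in t -> w \in t -> cluster_of (O `|` F) v w -> v = w.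
  by move=> /mapP[u us ->] /mapP[u' u's ->] /apart ->.
(* Either x lies in the (O `|` F)-cluster of a representative z, which is then
   replaced by x and y, or x is a new representative. *)
have [[z zt xz]|noz] := pselect (exists2 z, z \in t & cluster_of (O `|` F) x z).
  have far w : w \in rem z t -> ~ cluster_of (O `|` F) x w.
    rewrite mem_rem_uniq// inE => /andP[/eqP wz wt] xw; apply: wz.
    by apply: apart_t => //; exact: cluster_trans (cluster_sym xw) xz.
  have fary w : w \in rem z t -> ~ cluster_of (O `|` F) y w.
    by move=> /far nxw yw; apply: nxw; exact: cluster_trans xy yw.
  exists [:: x, y & rem z t]; split.
  - rewrite /= size_rem// size_map sz_s prednK//.
    by rewrite -sz_s -(size_map a) -/t; case: (t) zt.
  - rewrite /= rem_uniq// andbT inE negb_or -andbA; apply/and3P; split.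
    + by apply/eqP => exy; apply: nxy; rewrite exy; exact: cluster_refl.
    + by apply/negP => /far; apply; exact: cluster_refl.
    + by apply/negP => /fary; apply; exact: cluster_refl.
  - by move=> w; rewrite !inE => /or3P[/eqP->|/eqP->|/mem_rem/inf_t].
  - move=> v w; rewrite !inE => /or3P[/eqP->|/eqP->|vr] /or3P[/eqP->|/eqP->|wr]//.
    + by move=> /up /(far _ wr).
    + by move=> /cluster_sym xy'.
    + by move=> /up /(fary _ wr).
    + by move=> /cluster_sym /up /(far _ vr).
    + by move=> /cluster_sym /up /(fary _ vr).
    + by move=> /up; apply: apart_t; [exact: mem_rem vr|exact: mem_rem wr].
have far w : w \in t -> ~ cluster_of (O `|` F) x w.
  by move=> wt xw; apply: noz; exists w.
exists (x :: t); split.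
- by rewrite /= size_map sz_s.
- by rewrite /= uniq_t andbT; apply/negP => /far; apply; exact: cluster_refl.
- by move=> w; rewrite inE => /orP[/eqP->|/inf_t].
- move=> v w; rewrite !inE => /orP[/eqP->|vt] /orP[/eqP->|wt] //.
  + by move=> /up /(far _ wt).
  + by move=> /cluster_sym /up /(far _ vt).
  + by move=> /up; apply: apart_t.
Qed.

Section counting.
Variable R : realType.

Lemma counting_clusters0 A O : ~ many_clusters A 1 O ->
  counting (infinite_clusters A O) = 0%E :> \bar R.
Proof.
move=> no1; suff -> : infinite_clusters A O = set0.
  by rewrite /counting asboolT// fset_set0 cardfs0.
apply/seteqP; split=> // K [[x _ <-] infx]; apply: no1; exists [:: x]; split=> //.
  by move=> y; rewrite inE => /eqP ->.
by move=> y z; rewrite !inE => /eqP -> /eqP ->.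
Qed.

Lemma counting_clusters1 A O : many_clusters A 1 O -> ~ many_clusters A 2 O ->
  counting (infinite_clusters A O) = 1%E :> \bar R.
Proof.
move=> [s [sz_s _ inf_s _]] no2.
case: s sz_s inf_s => [|x [|//]]// _ inf_s.
have inf_x := inf_s x (mem_head _ _).
suff -> : infinite_clusters A O = [set cluster_of O x].
  by rewrite /counting asboolT// fset_set1 cardfs1.
apply/seteqP; split=> [K [[y _ <-] infy]|_ ->]; last by split=> //; exists x.
apply/cluster_eqP; apply: contrapT => nyx; apply: no2; exists [:: y; x]; split=> //.
- rewrite /= inE andbT; apply/eqP => yx; apply: nyx; rewrite yx.
  exact: cluster_refl.
- by move=> z; rewrite !inE => /orP[] /eqP ->.
- move=> u v; rewrite !inE => /orP[] /eqP -> /orP[] /eqP -> //.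
  by move=> /cluster_sym.
Qed.

Lemma counting_clusters_pinfty A O : (forall n, many_clusters A n O) ->
  counting (infinite_clusters A O) = +oo%E :> \bar R.
Proof.
move=> manyn; rewrite /counting asboolF// => finC.
have [s [sz_s uniq_s inf_s apart_s]] := manyn #|` fset_set (infinite_clusters A O)|.+1.
have : (size (map (cluster_of O) s) <= #|` fset_set (infinite_clusters A O)|)%N.
  apply: uniq_leq_size.
    rewrite map_inj_in_uniq// => x y xs ys /cluster_eqP; exact: apart_s.
  move=> K /mapP[x xs ->]; rewrite in_fset_set// inE; split; first by exists x.
  exact: inf_s.
by rewrite size_map sz_s ltnn.
Qed.

End counting.
End clusters.

(** * Measurability of the number of infinite clusters *)

Lemma bigcap_measurable_count d (T : measurableType d) (I : countType)
    (D : set I) (F : I -> set T) :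
  (forall i, D i -> measurable (F i)) -> measurable (\bigcap_(i in D) F i).
Proof.
move=> mF; rewrite -[X in measurable X]setCK setC_bigcap bigcup_mkcond.
apply: measurableC; apply: countable_bigcupT_measurable => // i.
by case: ifPn => // /set_mem Di; exact/measurableC/mF.
Qed.

Lemma bigcup_measurable_count d (T : measurableType d) (I : countType)
    (D : set I) (F : I -> set T) :
  (forall i, D i -> measurable (F i)) -> measurable (\bigcup_(i in D) F i).
Proof.
move=> mF; rewrite bigcup_mkcond.
apply: countable_bigcupT_measurable => // i.
by case: ifPn => // /set_mem Di; exact: mF.
Qed.

Section measurability.
Variables (V : countType) (E : set (set V)).
Implicit Types (x y : V) (A : set V) (n : nat).

(** Unlike the inductive connectivity relation, reachability in a fixed number
of steps is visibly a countable combination of cylinders. *)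
Fixpoint reach n x y : set (set (set V)) :=
  if n is m.+1 then
    \bigcup_z (reach m x z `&` [set O | (O `&` E) [set z; y]])
  else [set O | x = y].

Lemma measurable_reach n x y : measurable (reach n x y : set (config E)).
Proof.
elim: n y => [|n IHn] y /=.
  have [xy|xy] := pselect (x = y).
    by rewrite [X in measurable X](_ : _ = setT)//; apply/seteqP; split.
  by rewrite [X in measurable X](_ : _ = set0)//; apply/seteqP; split.
apply: bigcup_measurable_count => z _; apply: measurableI => //.
have [Ezy|nEzy] := pselect (E [set z; y]).
  rewrite [X in measurable X](_ : _ = [set O : config E | O [set z; y]]).
    exact: measurable_open_edge.
  by apply/seteqP; split=> O /= => [[]|].
by rewrite [X in measurable X](_ : _ = set0)//; apply/seteqP; split=> O // [].
Qed.

Lemma cluster_reach x y :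
  [set O | cluster_of (O `&` E) x y] = \bigcup_n reach n x y.
Proof.
apply/seteqP; split=> O /=.
  move=> xy; elim: (clos_rt_rtn1 _ _ _ _ xy) => [|u v uv _ [n _ xu]].
    by exists 0%N.
  by exists n.+1 => //=; exists u.
move=> [n _]; elim: n y => [|n IHn] y /=; first by move=> ->; exact: cluster_refl.
by move=> [z _ [/IHn xz zy]]; apply: cluster_trans xz _; exact: rt_step.
Qed.

Lemma measurable_cluster x y :
  measurable ([set O | cluster_of (O `&` E) x y] : set (config E)).
Proof.
rewrite cluster_reach; apply: bigcup_measurable_count => n _.
exact: measurable_reach.
Qed.

Lemma infinite_set_pickle A :
  infinite_set A <-> forall n, exists2 y, A y & (n <= choice.pickle y)%N.
Proof.
split=> [infA n|unbA finA].
  apply: contrapT => none; apply: infA.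
  apply: (@sub_finite_set _ _ (choice.pickle @^-1` `I_n)).
    by move=> y Ay /=; rewrite ltnNge; apply/negP => ny; apply: none; exists y.
  by apply: finite_preimage => // y z _ _; exact: (pcan_inj choice.pickleK).
have [y Ay] := unbA (\max_(z <- fset_set A) choice.pickle z).+1%N.
apply/negP; rewrite -leqNgt; apply: (@leq_bigmax_seq _ _ xpredT) => //.
by rewrite in_fset_set// inE.
Qed.

Lemma measurable_infinite_cluster A x :
  measurable ([set O | infinite_set (cluster_of (O `&` E) x `&` A)]
              : set (config E)).
Proof.
rewrite [X in measurable X](_ : _ = \bigcap_n \bigcup_(y in [set y | A y /\
  (n <= choice.pickle y)%N]) [set O | cluster_of (O `&` E) x y]); last first.
  apply/seteqP; split=> O /=.
    by move=> /infinite_set_pickle unb n _; have [y [xy Ay] ny] := unb n; exists y.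
  move=> unb; apply/infinite_set_pickle => n.
  by have [y [Ay ny] xy] := unb n I; exists y.
apply: bigcap_measurable_count => n _; apply: bigcup_measurable_count => y _.
exact: measurable_cluster.
Qed.

Lemma measurable_many_clusters_count A n :
  measurable ([set O | many_clusters A n (O `&` E)] : set (config E)).
Proof.
rewrite [X in measurable X](_ : _ =
  \bigcup_(s in [set s : seq V | size s = n /\ uniq s])
   ((\bigcap_(x in [set` s]) [set O | infinite_set (cluster_of (O `&` E) x `&` A)])
   `&` \bigcap_(xy in [set xy | [/\ xy.1 \in s, xy.2 \in s & xy.1 <> xy.2]])
     ~` [set O | cluster_of (O `&` E) xy.1 xy.2])); last first.
  apply/seteqP; split=> O /=.
    move=> [s [sz_s uniq_s inf_s apart_s]]; exists s => //; split=> // -[x y] /=.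
    by move=> [xs ys nxy] xy; apply: nxy; exact: apart_s.
  move=> [s [sz_s uniq_s] [inf_s apart_s]]; exists s; split=> // x y xs ys xy.
  by apply: contrapT => nxy; exact: (apart_s (x, y)).
apply: bigcup_measurable_count => s _; apply: measurableI.
  by apply: bigcap_measurable_count => x _; exact: measurable_infinite_cluster.
apply: bigcap_measurable_count => xy _; apply: measurableC.
exact: measurable_cluster.
Qed.

End measurability.

Lemma measurable_many_clusters (V : choiceType) (E : set (set V)) (A : set V) n :
  countable [set: V] ->
  measurable ([set O | many_clusters A n (O `&` E)] : set (config E)).
Proof.
move=> /pcard_leP/unsquash f.
pose VC : countType := HB.pack V (PCanIsCountable (in1TT 'funoK_f)).
exact: (@measurable_many_clusters_count VC).
Qed.

(** * Cayley graphs and translations *)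

Section cayley_graph.
Variables (Gamma : groupType) (S : seq Gamma).
Hypothesis genS : generates S.
Local Notation E := (cayley_edges S).
Implicit Types (g h x y : Gamma) (O : set (set Gamma)).

(** The words in the generators and their inverses form a countable subgroup
that contains S. *)
Lemma generates_countable : countable [set: Gamma].
Proof.
pose letter (ib : nat * bool) : Gamma :=
  let a := nth 1%g S ib.1 in if ib.2 then a else a^-1%g.
pose word (w : seq (nat * bool)) : Gamma :=
  foldr (fun ib g => letter ib * g)%g 1%g w.
have word_cat w w' : word (w ++ w') = (word w * word w')%g.
  by elim: w => [|ib w IHw] /=; rewrite ?mul1g// IHw mulgA.
(* A letter is a position in S with a sign; letters at positions beyond the end
   of S stand for 1. *)
pose flip (ib : nat * bool) := (ib.1, ~~ ib.2).
have word_inv w : word (rev (map flip w)) = (word w)^-1%g.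
  elim: w => [|[i b] w IHw] /=; first by rewrite invg1.
  rewrite rev_cons -cats1 word_cat IHw /= mulg1 invgM; congr (_ * _)%g.
  by case: b; rewrite /letter//= invgK.
pose K : {pred Gamma} := fun g => `[< range word g >].
have KP g : reflect (range word g) (g \in K) by exact: asboolP.
suff KT g : g \in K.
  apply: (@sub_countable _ _ _ (range word)).
    by apply: subset_card_le => g _; exact/KP.
  by apply: sub_countable (card_image_le _ _) _; exact: countableP.
apply: genS => [|a aS].
  split; first by apply/KP; exists [::].
  move=> _ _ /KP[v _ <-] /KP[w _ <-]; apply/KP.
  by exists (v ++ rev (map flip w)) => //; rewrite word_cat word_inv.
apply/KP; exists [:: (index a S, true)] => //=.
by rewrite /letter /= nth_index// mulg1.
Qed.

Definition shift h (e : set Gamma) : set Gamma := [set (h * g)%g | g in e].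

Lemma shift_inj h : injective (shift h).
Proof.
have sub e e' : shift h e = shift h e' -> e `<=` e'.
  move=> ee' g eg; have : shift h e (h * g)%g by exists g.
  by rewrite ee' => -[g' e'g' /mulgI <-].
by move=> e e' ee'; apply/seteqP; split; exact: sub.
Qed.

Lemma shift_pair h x y : shift h [set x; y] = [set (h * x)%g; (h * y)%g].
Proof. by rewrite /shift image_setU !image_set1. Qed.

Lemma shift_edge h (e : set Gamma) : E e -> E (shift h e).
Proof.
move=> [g [s [sS s1 ->]]]; exists (h * g)%g, s; split=> //.
by rewrite shift_pair mulgA.
Qed.

Lemma shiftK h : cancel (shift h) (shift h^-1%g).
Proof.
move=> e; apply/seteqP; split=> g.
  by move=> [_ [g' eg' <-] <-]; rewrite mulKg.
by move=> eg; exists (h * g)%g; [exists g|rewrite mulKg].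
Qed.

Local Notation translate h := (@relabel _ E (shift h)).

(** A translation is determined by the image of one vertex, and an edge has only
two vertices that this image can be. *)
Lemma finite_shift (H : set Gamma) (e e' : set Gamma) : E e -> E e' ->
  finite_set (H `&` [set h | shift h e = e']).
Proof.
move=> [g [s [_ _ ->]]] [g' [s' [_ _ ->]]]; apply: finite_setIr.
apply: (@sub_finite_set _ _ [set (g' / g)%g; (g' * s' / g)%g]) => // h /=.
rewrite shift_pair => eq_e.
have : [set g'; (g' * s')%g] (h * g)%g by rewrite -eq_e; left.
by case=> <-; [left|right]; rewrite mulgK.
Qed.

(** The elements g such that every x is connected to x * g form a subgroup that
contains S. *)
Lemma connected_cayley x y : cluster_of E x y.
Proof.
pose K : {pred Gamma} := fun g => `[< forall x, cluster_of E x (x * g)%g >].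
have KP g : reflect (forall x, cluster_of E x (x * g)%g) (g \in K).
  exact: asboolP.
suff : (x^-1 * y)%g \in K by move=> /KP /(_ x); rewrite mulVKg.
apply: genS => [|s sS].
  split; first by apply/KP => z; rewrite mulg1; exact: cluster_refl.
  move=> g h /KP Kg /KP Kh; apply/KP => z; rewrite mulgA.
  apply: cluster_trans (Kg z) _; apply: cluster_sym.
  by have := Kh (z * g / h)%g; rewrite mulgVK.
apply/KP => z; have [->|s1] := eqVneq s 1%g.
  by rewrite mulg1; exact: cluster_refl.
by apply: rt_step; exists z, s.
Qed.

Section subgroup.
Variable H : {pred Gamma}.
Hypothesis subgroupH : group_closed H.

Lemma cluster_relabel_shift h O x y : cluster_of (translate h O `&` E) x y ->
  cluster_of (O `&` E) (h * x)%g (h * y)%g.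
Proof.
elim=> [u v [Ouv Euv]|u|u v w _ uv _ vw].
- apply: rt_step; rewrite -shift_pair; split=> //; exact: shift_edge.
- exact: rt_refl.
- exact: rt_trans uv vw.
Qed.

Lemma relabel_shiftK h O : translate h^-1%g (translate h O) = O.
Proof.
have := shiftK h^-1%g; rewrite invgK => shiftVK.
by rewrite /relabel -comp_preimage; apply/seteqP; split=> e; rewrite /= shiftVK.
Qed.

(** Left translation by h^-1 maps the clusters of O onto those of the translated
configuration, and H onto itself. *)
Lemma many_clusters_relabel_sub h O n : h \in H ->
  many_clusters [set` H] n (O `&` E) ->
  many_clusters [set` H] n (translate h O `&` E).
Proof.
have HM := group_closedM subgroupH.
move=> hH [s [sz_s uniq_s inf_s apart_s]].
have hVH : (h^-1)%g \in H by exact: group_closedV.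
exists [seq (h^-1 * g)%g | g <- s]; split.
- by rewrite size_map.
- by rewrite map_inj_uniq//; exact: mulgI.
- move=> _ /mapP[x xs ->] fin; apply: (inf_s x xs).
  apply: sub_finite_set (finite_image (fun g => h * g)%g fin) => y [xy Hy].
  exists (h^-1 * y)%g; last by rewrite mulVKg.
  split; last exact: HM.
  by apply: cluster_relabel_shift; rewrite relabel_shiftK.
- move=> _ _ /mapP[x xs ->] /mapP[y ys ->] /cluster_relabel_shift.
  by rewrite !mulVKg => /apart_s ->.
Qed.

Lemma many_clusters_relabel h n : h \in H ->
  translate h @^-1` [set O : config E | many_clusters [set` H] n (O `&` E)]
  = [set O : config E | many_clusters [set` H] n (O `&` E)].
Proof.
move=> hH; apply/seteqP; split=> O /=; last exact: many_clusters_relabel_sub.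
move=> /(many_clusters_relabel_sub (group_closedV subgroupH hH)).
by rewrite relabel_shiftK.
Qed.

End subgroup.
End cayley_graph.

(** * The almost sure number of clusters *)

Lemma negligible_bigcup_count d (T : measurableType d) (R : realType)
    (mu : {measure set T -> \bar R}) (I : Type) (F : I -> set T) :
  countable [set: I] -> (forall i, mu.-negligible (F i)) ->
  mu.-negligible (\bigcup_i F i).
Proof.
move=> /countable_injP[f injf] nullF.
apply: (@negligibleS _ _ _ _ (\bigcup_n \bigcup_(i in [set i | f i = n]) F i)).
  by move=> x [i _ Fix]; exists (f i) => //; exists i.
apply: negligible_bigcup => n.
have [[i fi]|none] := pselect (exists i, f i = n).
  apply: negligibleS _ (nullF i) => x [j /= fj Fjx].
  by rewrite (injf i j) ?inE// fi fj.
apply: (negligibleS _ (negligible_set0 _)) => x [i /= fi _]; apply: none; by exists i.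
Qed.

Section almost_sure_count.
Variables (R : realType) (Gamma : groupType) (S : seq Gamma) (genS : generates S).
Variables (H : {pred Gamma}) (subgroupH : group_closed H).
Hypothesis infH : infinite_set [set` H].
Local Notation E := (cayley_edges S).
Variables (p : R) (mu : probability (config E) R).
Hypothesis lawmu : bernoulli_law p mu.
Hypothesis p_ge0 : 0 <= p.

Let at_least n : set (config E) := [set O | many_clusters [set` H] n (O `&` E)].

Let mat_least n : measurable (at_least n).
Proof. by apply: measurable_many_clusters; exact: generates_countable genS. Qed.

Lemma at_least_zero_one n : mu (at_least n) = 0%E \/ mu (at_least n) = 1%E.
Proof.
apply: (invariant_zero_one lawmu infH (phi := @shift Gamma)) => //.
- exact: shift_inj.
- by move=> h e; exact: shift_edge.
- by move=> e e'; exact: finite_shift.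
- by move=> h Hh; exact: many_clusters_relabel.
Qed.

Let mu_setC n : mu (at_least n) = 1%E -> mu.-negligible (~` at_least n).
Proof.
move=> n_as; apply/negligibleP; first exact: measurableC.
apply: etrans (probability_setC mu (mat_least n)) _; by rewrite n_as subee.
Qed.

(** Almost surely no edge is open, and then every cluster is a single vertex. *)
Lemma at_least_one_null : p = 0 -> mu (at_least 1) = 0%E.
Proof.
move=> p0; apply/(negligibleP _ (mat_least 1)).
have cG := generates_countable genS.
apply: (@negligibleS _ _ _ _ (\bigcup_x \bigcup_y
    [set O : config E | E [set x; y] /\ O [set x; y]])).
  move=> O [s [sz_s _ inf_s _]].
  have [x xs] : exists x, x \in s.
    by case: s sz_s {inf_s} => // x s _; exists x; exact: mem_head.
  apply: contrapT => closed; apply: (inf_s x xs).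
  apply: (@sub_finite_set _ _ [set x]) => // y [xy _].
  elim: (clos_rt_rtn1 _ _ _ _ xy) => // u v [Ouv Euv] _ _; exfalso.
  by apply: closed; exists u => //; exists v.
apply: negligible_bigcup_count => // x; apply: negligible_bigcup_count => // y.
have [Exy|nExy] := pselect (E [set x; y]); last first.
  by apply: (negligibleS _ (negligible_set0 _)) => O [].
have FE : [set` [fset [set x; y]]%fset] `<=` E by move=> e /=; rewrite inE => /eqP ->.
apply: (@negligibleS _ (config E) _ mu (all_open [fset [set x; y]]%fset)).
  by move=> O [_ Oxy] e /=; rewrite inE => /eqP ->.
apply/negligibleP; first exact: measurable_all_open.
by apply: etrans (lawmu FE) _; rewrite cardfs1 expr1 p0.
Qed.

(** If there were almost surely exactly n >= 2 clusters, a path opened between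
two of them would leave at most n - 1. *)
Lemma at_least_succ n : 0 < p -> mu (at_least 2) = 1%E ->
  mu (at_least n) = 1%E -> mu (at_least n.+1) = 1%E.
Proof.
move=> p0 two_as n_as.
have [n1_null|//] := at_least_zero_one n.+1.
have /choice[F FP] (xy : Gamma * Gamma) : exists J : {fset set Gamma},
    [set` J] `<=` E /\ cluster_of [set` J] xy.1 xy.2.
  by have [J] := cluster_finite_path (connected_cayley genS xy.1 xy.2); exists J.
have cG := generates_countable genS.
have : mu.-negligible (~` at_least 2 `|` at_least n.+1 `|` \bigcup_x \bigcup_y
   (@insert_edges _ E (F (x, y)) @^-1` (~` at_least n))).
  apply: negligibleU; first apply: negligibleU; first exact: mu_setC.
    exact/negligibleP.
  apply: negligible_bigcup_count => // x; apply: negligible_bigcup_count => // y.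
  have [FE _] := FP (x, y).
  have mC : measurable (~` at_least n) by exact: measurableC.
  apply/negligibleP.
    by apply: measurable_preimage_config => //; exact: measurable_insert_edges.
  apply: (null_insert lawmu) => //; apply/negligibleP => //; exact: mu_setC.
move=> nullU; exfalso.
suff /negligibleS/(_ nullU)/(negligibleP _ measurableT) : [set: config E] `<=`
    ~` at_least 2 `|` at_least n.+1 `|` \bigcup_x \bigcup_y
    (@insert_edges _ E (F (x, y)) @^-1` (~` at_least n)).
  by move=> /(etrans (esym (probability_setT mu))) /eqP; rewrite onee_eq0.
move=> O _; have [two_O|nottwo] := pselect (at_least 2 O); last first.
  by left; left; exact: nottwo.
have [n1_O|notn1] := pselect (at_least n.+1 O); first by left; right.
right; have [s [sz_s uniq_s inf_s apart_s]] := two_O.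
case: s sz_s uniq_s inf_s apart_s => [|x [|y [|//]]]// _ uniq_s inf_s apart_s.
exists x => //; exists y => //= insn; apply: notn1.
have [FE Fxy] := FP (x, y).
have finZ : finite_set (\bigcup_(e in [set` F (x, y)]) e).
  apply: bigcup_finite => // e /FE [g [t [_ _ ->]]]; exact: finite_set2.
apply: (many_clusters_merge (n := n) (F := [set` F (x, y)]) (x := x) (y := y) finZ).
- by move=> u v Fuv; exists [set u; v] => //; left.
- by apply: inf_s; rewrite !inE eqxx.
- by apply: inf_s; rewrite !inE eqxx orbT.
- move=> /apart_s exy; move: uniq_s.
  by rewrite exy //= !inE eqxx ?orbT.
- exact: sub_cluster (@subsetUr _ _ _) _ _ Fxy.
- by move: insn; rewrite /at_least /= /insert_edges setIUl (setIidl FE).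
Qed.

(** The zero-one law is applied to at least 1 and at least 2 clusters; beyond 2,
at_least_succ takes over. *)
Lemma almost_sure_cluster_number : exists k : \bar R,
  [\/ k = 0%E, k = 1%E | k = +oo%E] /\
  mu.-negligible [set O | counting (infinite_clusters [set` H] (O `&` E)) <> k].
Proof.
have [one_null|one_as] := at_least_zero_one 1.
  exists 0%E; split; first by constructor 1.
  apply: (@negligibleS _ _ _ _ (at_least 1)); last exact/negligibleP.
  by move=> O /= count; apply: contrapT => /counting_clusters0.
have [two_null|two_as] := at_least_zero_one 2.
  exists 1%E; split; first by constructor 2.
  apply: (@negligibleS _ _ _ _ (~` at_least 1 `|` at_least 2)).
    move=> O /= count; apply: contrapT => /not_orP[/contrapT O1 O2].
    by apply: count; exact: counting_clusters1.
  by apply: negligibleU; [exact: mu_setC|exact/negligibleP].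
have p_gt0 : 0 < p.
  rewrite lt_neqAle p_ge0 andbT; apply/eqP => /esym/at_least_one_null.
  by rewrite one_as => /eqP; rewrite onee_eq0.
have all_as n : mu (at_least n) = 1%E.
  elim: n => [|n IHn]; last exact: at_least_succ.
  rewrite (_ : at_least 0 = setT) ?probability_setT//.
  by apply/seteqP; split=> // O _; exact: many_clusters0.
exists +oo%E; split; first by constructor 3.
apply: (@negligibleS _ _ _ _ (\bigcup_n ~` at_least n)); last first.
  by apply: negligible_bigcup => n; exact: mu_setC.
move=> O /= count; apply: contrapT => notU; apply: count.
apply: counting_clusters_pinfty => n; apply: contrapT => notn.
by apply: notU; exists n.
Qed.

End almost_sure_count.

Theorem lemma1p3 (R : realType) (Gamma : groupType) (S : seq Gamma)
    (genS : generates S) (H : {pred Gamma}) (subgroupH : group_closed H)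
    (infH : infinite_set [set` H]) (p : R) (p01 : 0 <= p <= 1) :
  exists k : \bar R, [\/ k = 0%E, k = 1%E | k = +oo%E] /\
    forall (d : measure_display) (Omega : measurableType d)
      (P : probability Omega R) (W : Omega -> set (set Gamma)),
      bernoulli_percolation P (cayley_edges S) p W ->
      {ae P, forall w : Omega,
        counting (infinite_clusters [set` H] (W w)) = k}.
Proof.
have p0 : 0 <= p by case/andP: p01.
(* The constant is read off from any percolation with parameter p; all the
   others have the same law. If there is none, any constant will do. *)
have [[mu0 law0]|nolaw] := pselect
    (exists mu : probability (config (cayley_edges S)) R, bernoulli_law p mu).
  have [k [k01oo [N [mN N0 subN]]]] :=
    almost_sure_cluster_number genS subgroupH infH law0 p0.
  exists k; split=> // d Omega P W percW.
  have [mW lawW] := bernoulli_percolation_law percW.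
  exists (W @^-1` N); split.
  - exact: measurable_preimage_config mW mN.
  - rewrite -[LHS]/(image_law P mW N) -N0; apply: config_measure_unique => //.
      by rewrite (le_lt_trans (probability_le1 _ _)) ?ltry.
    by move=> J JE; exact: etrans (lawW J JE) (esym (law0 J JE)).
  - move=> w /= neq_k; apply: subN => /= eq_k; apply: neq_k.
    have [WE _ _ _] := percW; rewrite -[W w](setIidl (WE w)); exact: eq_k.
exists 0%E; split; first by constructor 1.
move=> d Omega P W /bernoulli_percolation_law[mW lawW].
by case: nolaw; exists (image_law P mW).
Qed.
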